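(* Let $\mathcal{M}$ be a Riemannian manifold and let $\mathcal{T}_{\boldsymbol{\alpha}}$ be a stable subdivision scheme over $\mathcal{M}$, with corresponding decimation operator $\mathcal{Y}_{\boldsymbol{\zeta}}$. Then there exists a constant $K\ge 0$ such that the detail coefficients generated from an $\mathcal{M}$-valued sequence $\boldsymbol{c}^{(J)}$, $J\in\mathbb{N}$, by the multiscale transform $$\boldsymbol{c}^{(\ell-1)}=\mathcal{Y}_{\boldsymbol{\zeta}}\boldsymbol{c}^{(\ell)},\qquad \boldsymbol{d}^{(\ell)}=\boldsymbol{c}^{(\ell)}\ominus\mathcal{T}_{\boldsymbol{\alpha}}\boldsymbol{c}^{(\ell-1)},\qquad \ell=1,2,\dots,J,$$ satisfy $$\|\boldsymbol{d}^{(\ell)}\|_\infty\le K\,\Delta_{\mathcal{M}}(\boldsymbol{c}^{(\ell)}),\qquad \ell=1,2,\dots,J,$$ where $\|\boldsymbol{d}^{(\ell)}\|_\infty=\sup_{k\in\mathbb{Z}}\|d^{(\ell)}_k\|$.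
   Context: All sequences are bi-infinite, indexed by $\mathbb{Z}$. $\mathcal{M}$ is a Riemannian manifold with geodesic distance $\rho$. For $\mathcal{M}$-valued sequences, $(\boldsymbol{c}\downarrow 2)_k=c_{2k}$, $\Delta_{\mathcal{M}}(\boldsymbol{c})=\sup_{k}\rho(c_{k+1},c_k)$ and $\mu(\boldsymbol{c},\boldsymbol{m})=\sup_{k}\rho(c_k,m_k)$. Masks. $\boldsymbol{\alpha}$ is a finitely supported real sequence with $\sum_i\alpha_{2i}=\sum_i\alpha_{2i+1}=1$ (shift invariance), the mask of a convergent linear subdivision scheme. $\boldsymbol{\gamma}$ is a real sequence solving $\boldsymbol{\gamma}\ast(\boldsymbol{\alpha}\downarrow 2)=\boldsymbol{\delta}$ ($\boldsymbol\delta$ the Kronecker delta sequence); it satisfies $\sum_i\gamma_i=1$ and $|\gamma_k|\le C\lambda^{|k|}$ for some $C>0$, $0<\lambda<1$. For a fixed $\varepsilon>0$, put $\widetilde\gamma_k=\gamma_k$ if $|\gamma_k|>\varepsilon$ and $\widetilde\gamma_k=0$ otherwise (finite support $\Omega_\varepsilon$), and $\zeta_k=\widetilde\gamma_k/\sum_{i\in\Omega_\varepsilon}\widetilde\gamma_i$ (the denominator being nonzero), so $\sum_k\zeta_k=1$ (shift invariance of $\boldsymbol\zeta$). Operators. $\mathcal{T}_{\boldsymbol{\alpha}}(\boldsymbol{c})_k=\arg\min_{x\in\mathcal{M}}\sum_i\alpha_{k-2i}\,\rho(x,c_i)^2$ and the corresponding decimation operator is $\mathcal{Y}_{\boldsymbol{\zeta}}(\boldsymbol{c})_k=\arg\min_{x\in\mathcal{M}}\sum_i\zeta_{k-i}\,\rho(x,c_{2i})^2$.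 A sequence is admissible if all these minimization problems (for shift invariant masks $\boldsymbol\alpha$, $\boldsymbol\zeta$) have a unique solution. Standing assumption: all $\mathcal{M}$-valued sequences to which the operators are applied are admissible. Stability: $\mathcal{T}$ is stable if there is $S_{\mathcal{T}}\ge0$ with $\mu(\mathcal{T}\boldsymbol{c},\mathcal{T}\boldsymbol{m})\le S_{\mathcal{T}}\,\mu(\boldsymbol{c},\boldsymbol{m})$ for all (admissible) $\mathcal{M}$-valued sequences $\boldsymbol{c},\boldsymbol{m}$. Exp/log: $p\oplus v=\exp_p(v)$ for $v\in T_p\mathcal{M}$ and $q\ominus p=\log_p(q)\in T_p\mathcal{M}$ is its inverse, applied elementwise to sequences; it is assumed that all logarithms that appear are defined (points within injectivity radius), so that $\|q\ominus p\|=\rho(p,q)$, with $\|\cdot\|$ the Riemannian norm on the tangent space. *)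

(* Defs.v *)
From HB Require Import structures.
From mathcomp Require Import all_boot all_order all_algebra.
From mathcomp Require Import all_classical all_reals all_analysis.

Set Implicit Arguments.
Unset Strict Implicit.
Unset Printing Implicit Defensive.

Import Order.TTheory GRing.Theory Num.Theory.
Import numFieldNormedType.Exports.

Local Open Scope classical_set_scope.
Local Open Scope ring_scope.

(* Intended for an open U in a finite-dimensional V, where membership of all
   iterated directional derivatives in C^0 is the usual C^k condition. *)
Fixpoint Ck_on (R : realType) (V W : normedModType R) (k : nat) (U : set V)
    (f : V -> W) : Prop :=
  match k with
  | 0 => forall x, U x -> {for x, continuous f}
  | k'.+1 => (forall x, U x -> differentiable f x) /\
             (forall v, Ck_on k' U ('D_v f))
  end.

Definition smooth_on (R : realType) (V W : normedModType R) (U : set V)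
    (f : V -> W) : Prop :=
  forall k, Ck_on k U f.

(* A connected smooth n-manifold without boundary, given by a smooth atlas.
   Each chart is a total function, meaningful on its domain only; chart_inv is
   its inverse on the chart image. The reference chart chart_at p is used only
   to represent tangent vectors at p. *)
Record smooth_manifold (R : realType) (n : nat) := SmoothManifold {
  carrier :> topologicalType;
  carrier_hausdorff : hausdorff_space carrier;
  carrier_second_countable : @second_countable carrier;
  carrier_connected : connected [set: carrier];
  chart_index : Type;
  chart_dom : chart_index -> set carrier;
  chart : chart_index -> carrier -> 'rV[R]_n;
  chart_inv : chart_index -> 'rV[R]_n -> carrier;
  chart_at : carrier -> chart_index;
  chart_at_dom : forall p, chart_dom (chart_at p) p;
  chart_dom_open : forall i, open (chart_dom i);
  chart_img_open : forall i, open (chart i @` chart_dom i);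
  chartK : forall i p, chart_dom i p -> chart_inv i (chart i p) = p;
  chart_continuous :
    forall i p, chart_dom i p -> {for p, continuous (chart i)};
  chart_inv_continuous :
    forall i x, (chart i @` chart_dom i) x -> {for x, continuous (chart_inv i)};
  transition_smooth : forall i j,
    smooth_on (chart i @` (chart_dom i `&` chart_dom j))
              (chart j \o chart_inv i)
}.

(* A Riemannian metric, given by its Gram matrix in every chart; metric_compat
   says that these local expressions define one tensor on the manifold. *)
Record riemannian_manifold (R : realType) (n : nat) := RiemannianManifold {
  manifold :> smooth_manifold R n;
  metric : chart_index manifold -> 'rV[R]_n -> 'M[R]_n;
  metric_smooth : forall i, smooth_on (chart i @` chart_dom i) (metric i);
  metric_sym : forall i p, chart_dom i p ->
    (metric i (chart i p))^T = metric i (chart i p);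
  metric_posdef : forall i p, chart_dom i p -> forall v : 'rV[R]_n, v != 0 ->
    0 < (v *m metric i (chart i p) *m v^T) 0 0;
  metric_compat : forall i j p, chart_dom i p -> chart_dom j p ->
    forall u v : 'rV[R]_n,
    let pushforward w := 'D_w (chart j \o chart_inv i) (chart i p) in
    (u *m metric i (chart i p) *m v^T) 0 0 =
    (pushforward u *m metric j (chart j p) *m (pushforward v)^T) 0 0
}.

Section Riemannian.
Variables (R : realType) (n : nat) (M : riemannian_manifold R n).

(* T_pM, in the coordinates of the reference chart at p. *)
Definition tangent (p : M) : Type := 'rV[R]_n.

Definition tangent_norm (p : M) (v : tangent p) : R :=
  let i := chart_at p in
  Num.sqrt (((v : 'rV[R]_n) *m metric i (chart i p) *m (v : 'rV[R]_n)^T) 0 0).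

Arguments tangent_norm p v : clear implicits.

(* gamma restricted to [0, 1] is a C^k curve; only its values near [0, 1]
   matter. *)
Definition Ck_curve (k : nat) (gamma : R -> M) : Prop :=
  exists U : set R, [/\ open U, `[0, 1] `<=` U,
    (forall t, U t -> {for t, continuous gamma}) &
    forall i, Ck_on k (U `&` gamma @^-1` chart_dom i) (chart i \o gamma)].

Definition velocity (gamma : R -> M) (t : R) : tangent (gamma t) :=
  'D_1 (chart (chart_at (gamma t)) \o gamma) t.

Definition curve_length (gamma : R -> M) : R :=
  Rintegral (@lebesgue_measure R) `[0, 1]
    (fun t => tangent_norm (gamma t) (velocity gamma t)).

(* A piecewise C^1 curve from p to q, as the list of its C^1 pieces, each
   reparametrized over [0, 1]. *)
Fixpoint piecewise_C1 (p : M) (s : seq (R -> M)) (q : M) : Prop :=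
  match s with
  | [::] => p = q
  | gamma :: s' =>
      [/\ Ck_curve 1 gamma, gamma 0 = p & piecewise_C1 (gamma 1) s' q]
  end.

Definition geodesic_dist (p q : M) : R :=
  inf [set \sum_(gamma <- s) curve_length gamma |
        s in [set s | piecewise_C1 p s q]].

(* Christoffel symbol Gamma^k_{ab} of the Levi-Civita connection, in chart i. *)
Definition christoffel (i : chart_index M) (k a b : 'I_n) (x : 'rV[R]_n) : R :=
  let partial c d e :=
    'D_(delta_mx 0 c : 'rV[R]_n) (fun y => metric i y d e) x in
  2^-1 * \sum_(m < n) invmx (metric i x) k m *
    (partial a m b + partial b m a - partial m a b).

Definition is_geodesic (gamma : R -> M) : Prop :=
  Ck_curve 2 gamma /\
  forall t, 0 <= t <= 1 -> forall i, chart_dom i (gamma t) ->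
  let x : R -> 'rV[R]_n := chart i \o gamma in
  let x' : R -> 'rV[R]_n := 'D_1 x in
  forall k : 'I_n,
    'D_1 x' t 0 k +
    \sum_(a < n) \sum_(b < n)
      christoffel i k a b (x t) * x' t 0 a * x' t 0 b = 0.

(* exp_p(v) = q; a relation, as exp_p need not be defined on all of T_pM when
   M is not complete. *)
Definition is_exp (p : M) (v : tangent p) (q : M) : Prop :=
  exists gamma : R -> M,
    [/\ is_geodesic gamma, gamma 0 = p, gamma 1 = q &
        'D_1 (chart (chart_at p) \o gamma) 0 = v].

Arguments is_exp p v q : clear implicits.

(* v is a preimage of q under exp_p whose geodesic is minimizing. *)
Definition is_log (p q : M) (v : tangent p) : Prop :=
  is_exp p v q /\ tangent_norm p v = geodesic_dist p q.

Arguments is_log p q v : clear implicits.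

Definition log_defined (p q : M) : Prop := exists! v : tangent p, is_log p q v.

(* q (-) p = log_p(q); the value 0 is junk when the logarithm is undefined. *)
Definition ominus (q p : M) : tangent p :=
  xget (0 : 'rV[R]_n) [set v | is_log p q v].

Definition Delta (c : int -> M) : \bar R :=
  ereal_sup [set (geodesic_dist (c (k + 1)) (c k))%:E | k in [set: int]].

Definition mu_dist (c m : int -> M) : \bar R :=
  ereal_sup [set (geodesic_dist (c k) (m k))%:E | k in [set: int]].

(* All sums below have finitely many nonzero terms, since the masks alpha and
   zeta have finite support. *)
Definition refine_energy (alpha : int -> R) (c : int -> M) (k : int) (x : M)
    : R :=
  \sum_(i \in [set: int]) alpha (k - 2 * i) * geodesic_dist x (c i) ^+ 2.

Definition decimate_energy (zeta : int -> R) (c : int -> M) (k : int) (x : M)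
    : R :=
  \sum_(i \in [set: int]) zeta (k - i) * geodesic_dist x (c (2 * i)) ^+ 2.

Definition is_argmin (F : M -> R) (x : M) : Prop := forall y, F x <= F y.

(* The default c k is junk, reached only when there is no minimizer. *)
Definition refine (alpha : int -> R) (c : int -> M) : int -> M :=
  fun k => xget (c k) [set x | is_argmin (refine_energy alpha c k) x].

Definition decimate (zeta : int -> R) (c : int -> M) : int -> M :=
  fun k => xget (c k) [set x | is_argmin (decimate_energy zeta c k) x].

Definition admissible (alpha zeta : int -> R) (c : int -> M) : Prop :=
  forall k, (exists! x, is_argmin (refine_energy alpha c k) x) /\
            (exists! x, is_argmin (decimate_energy zeta c k) x).

Definition stable (alpha zeta : int -> R) : Prop :=
  exists2 S : R, 0 <= S & forall c m : int -> M,
    admissible alpha zeta c -> admissible alpha zeta m ->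
    (mu_dist (refine alpha c) (refine alpha m) <= S%:E * mu_dist c m)%E.

Definition detail (alpha : int -> R) (c : nat -> int -> M) (l : nat) (k : int)
    : tangent (refine alpha (c l.-1) k) :=
  ominus (c l k) (refine alpha (c l.-1) k).

Definition detail_norm (alpha : int -> R) (c : nat -> int -> M) (l : nat)
    : \bar R :=
  ereal_sup [set (tangent_norm (refine alpha (c l.-1) k) (detail alpha c l k))%:E | k in [set: int]].

End Riemannian.

Section Masks.
Variable R : realType.
Implicit Types (alpha gamma : int -> R).

Definition finitely_supported alpha : Prop :=
  finite_set [set i | alpha i != 0].

Definition shift_invariant alpha : Prop :=
  \sum_(i \in [set: int]) alpha (2 * i) = 1 /\
  \sum_(i \in [set: int]) alpha (2 * i + 1) = 1.

Definition linear_refine alpha (c : int -> R) : int -> R :=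
  fun k => \sum_(i \in [set: int]) alpha (k - 2 * i) * c i.

Definition subdivision_limit alpha (c : int -> R) (f : R -> R) : Prop :=
  continuous f /\
  forall e : R, 0 < e -> \forall j \near \oo, forall k : int,
    `|iter j (linear_refine alpha) c k - f (k%:~R / 2 ^+ j)| <= e.

Definition bounded_seq (c : int -> R) : Prop :=
  exists B : R, forall k, `|c k| <= B.

Definition convergent_subdivision alpha : Prop :=
  (forall c, bounded_seq c -> exists f, subdivision_limit alpha c f) /\
  (exists c f, [/\ bounded_seq c, subdivision_limit alpha c f &
                   exists x, f x != 0]).

Definition downsample (T : Type) (c : int -> T) : int -> T :=
  fun k => c (2 * k).

Definition kronecker : int -> R := fun k => (k == 0)%:R.

(* Convolution gamma * beta, for a finitely supported beta. *)
Definition convolution gamma (beta : int -> R) : int -> R :=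
  fun k => \sum_(i \in [set: int]) gamma (k - i) * beta i.

Definition exponential_decay gamma : Prop :=
  exists C lambda : R, [/\ 0 < C, 0 < lambda < 1 &
    forall k, `|gamma k| <= C * lambda ^+ `|k|%N].

Definition sums_to gamma (s : R) : Prop :=
  (fun N : nat => \sum_(i < N.+1) gamma (Posz i) + \sum_(i < N) gamma (Negz i))
    @ \oo --> s.

Definition truncated gamma (eps : R) : int -> R :=
  fun k => if eps < `|gamma k| then gamma k else 0.

Definition truncated_sum gamma (eps : R) : R :=
  \sum_(i \in [set i | eps < `|gamma i|]) truncated gamma eps i.

Definition decimation_mask gamma (eps : R) : int -> R :=
  fun k => truncated gamma eps k / truncated_sum gamma eps.

End Masks.

(* Main.v *)
(* For shift invariant weights w, a minimizer x of sum_i w_i rho(x, y_i)^2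
   satisfies rho(x, p) <= (2 A + 1) r, where A = sum_i |w_i| and p is any point
   with rho(p, y_i) <= r for all i in the support of w: the energy at p is at
   most A r^2, and the one at x is at least
   rho(x, p)^2 - A (2 rho(x, p) r + r^2).
   Applied to the decimation around c_(2k), and then to the refinement around
   c_k, it bounds both displacements by multiples of Delta(c).
   This only uses that rho is a pseudometric. As rho is an infimum, equal to 0
   on an empty set of curves, the triangle inequality also requires that any
   two points are joined by a piecewise C^1 curve. *)

Require Import Defs.
From HB Require Import structures.
From mathcomp Require Import all_boot all_order all_algebra.
From mathcomp Require Import all_classical all_reals all_analysis.
From mathcomp Require Import measurable_realfun.
From mathcomp Require Import zify lra ring.

Set Implicit Arguments.
Unset Strict Implicit.
Unset Printing Implicit Defensive.

Import Order.TTheory GRing.Theory Num.Theory.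
Import numFieldNormedType.Exports.

Local Open Scope classical_set_scope.
Local Open Scope ring_scope.

(** * Affine reparametrizations and segments in balls *)

Lemma derive_comp_affine (R : realType) (V W : normedModType R) (f : V -> W)
    (w x0 : V) (t v : R) :
  'D_v (fun s : R => f (s *: w + x0)) t = 'D_(v *: w) f (t *: w + x0).
Proof.
rewrite /derive; set F := (X in lim (X @ _)); set G := (X in _ = lim (X @ _)).
suff -> : F = G by [].
by apply/funext => h; rewrite /F /G /= scalerDl addrA scalerA.
Qed.

Lemma continuous_affine (R : realType) (V : normedModType R) (w x0 : V) :
  continuous (fun s : R => s *: w + x0).
Proof.
move=> t; apply: cvgD; last exact: cvg_cst.
exact: scalel_continuous.
Qed.

Lemma onem_affine (R : realType) (t : R) : t *: (-1) + 1 = 1 - t.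
Proof. by rewrite /GRing.scale /= mulrN1 addrC. Qed.

(** Balls are convex: the difference from [x] to a point of the segment is the same convex
    combination of [x - b] and [x - a]. *)
Lemma ball_segment (R : realType) (V : normedModType R) (x a b : V) (e t : R) :
  ball x e a -> ball x e b -> 0 <= t <= 1 -> ball x e (t *: (b - a) + a).
Proof.
rewrite -!ball_normE /= => xa xb /andP[t0 t1].
have -> : x - (t *: (b - a) + a) = t *: (x - b) + (1 - t) *: (x - a).
  rewrite [(1 - t) *: _]scalerBl scale1r addrCA -scalerBr opprB.
  rewrite [x - b + _]addrC subrKA (_ : a - b = - (b - a)); last by rewrite opprB.
  by rewrite scalerN opprD addrA addrAC.
apply: (le_lt_trans (ler_normD _ _)); rewrite !normrZ (ger0_norm t0).
rewrite ger0_norm ?subr_ge0//.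
(* The strict inequality is taken from the [x - b] term, which requires [0 < t]; the endpoint
   [t = 0] is therefore treated apart. *)
have [t0'|t0'] := eqVneq t 0; first by rewrite t0' subr0 mul0r add0r mul1r.
have tp : 0 < t by rewrite lt_neqAle eq_sym t0'.
have h1 : t * `|x - b| < t * e by rewrite ltr_pM2l.
have h2 : (1 - t) * `|x - a| <= (1 - t) * e by rewrite ler_wpM2l ?subr_ge0// ltW.
lra.
Qed.

(** A directional derivative of the composite is again a directional derivative of [f], in the
    scaled direction [v *: w], composed with the affine map; continuity is inherited. *)
Lemma Ck1_comp_affine (R : realType) (V W : normedModType R) (U : set V)
    (D : set R) (f : V -> W) (w x0 : V) :
  (forall s, D s -> U (s *: w + x0)) ->
  Ck_on 1 U f -> Ck_on 1 D (fun s : R => f (s *: w + x0)).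
Proof.
move=> DU [df cf]; split.
  move=> t /DU Ut.
  apply: (@differentiable_comp _ _ _ _ (fun s : R => s *: w + x0) f).
    exact: differentiableD.
  exact: df.
move=> v t /DU Ut.
have -> : 'D_v (fun s : R => f (s *: w + x0)) =
   'D_(v *: w) f \o (fun s : R => s *: w + x0).
  by apply/funext => s; rewrite derive_comp_affine.
apply: continuous_comp; first exact: continuous_affine.
exact: cf.
Qed.

(** * Invariance of the Lebesgue integral under t -> 1 - t *)

Section reflection.
Variable R : realType.
Local Notation mu := (@lebesgue_measure R).

Lemma measurable_onem : measurable_fun [set: measurableTypeR R]
  ((fun t => 1 - t) : measurableTypeR R -> measurableTypeR R).
Proof.
apply: continuous_measurable_fun => t.
by apply: cvgB; [exact: cvg_cst|exact: cvg_id].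
Qed.

(** By uniqueness of Lebesgue measure it suffices to test half-open intervals. The reflection moves
    the closed end to the other side but keeps the length. *)
Lemma lebesgue_measure_onem (A : set R) : measurable A ->
  mu ((fun t => 1 - t) @^-1` A) = mu A.
Proof.
move=> mA.
change (pushforward mu
  ((fun t : R => 1 - t) : _ -> measurableTypeR R) A = mu A).
have mo := measurable_onem.
apply/esym/(@lebesgue_measure_unique _ _ _ A mA) => /= _ [[a b]] _ <-.
rewrite /pushforward /=.
have -> : (fun t : R => 1 - t) @^-1` `]a, b] = `[1 - b, 1 - a[%classic.
  apply/seteqP; split => x /=; rewrite !in_itv /= => /andP[h1 h2];
    apply/andP; split; lra.
rewrite !lebesgue_measure_itv/= !lte_fin ltrD2l ltrN2.
by case: ifP => // _; rewrite -!EFinD; congr (_%:E); ring.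
Qed.

Import HBNNSimple.

(* The integral is a supremum over simple functions, so the inequality needs no
   measurability of f, which is not known for the speed of a curve here. *)
Lemma ge0_integral_onem_le (f g : R -> \bar R) :
  (forall x, 0 <= f x)%E -> (forall x, g x = f (1 - x)) ->
  (\int[mu]_x f x <= \int[mu]_x g x)%E.
Proof.
move=> f0 gE.
have g0 x : (0 <= g x)%E by rewrite gE.
rewrite [leLHS]ge0_integralTE//.
apply: ge_ereal_sup => _ [h /= hf <-].
have mo := measurable_onem.
(* The simple function [h] is measurable, so the change of variables is legitimate for it. *)
have -> : sintegral mu h = (\int[mu]_x (h (1 - x))%:E)%E.
  rewrite -integralT_nnsfun.
  rewrite -[in RHS](preimage_setT (fun t : R => 1 - t)).
  rewrite -(ge0_integral_pushforward mo mu measurableT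
    (f := fun x => (h x)%:E)).
  - by apply: eq_measure_integral => A mA _; rewrite /= -lebesgue_measure_onem.
  - exact/measurable_EFinP.
  - by move=> x _; rewrite lee_fin.
rewrite !ge0_integralTE//; last by move=> x; rewrite lee_fin.
apply: ereal_sup_le => _ [k /= kf <-]; exists k => //= x.
by rewrite gE (le_trans (kf x)).
Qed.

(** The integrands are extended by 0 outside the unit interval, which the reflection preserves. The
    reflection being an involution, the one-sided inequality applies in both directions. *)
Lemma Rintegral_onem (f : R -> R) : (forall x, 0 <= x <= 1 -> 0 <= f x) ->
  Rintegral mu `[0, 1] (fun t => f (1 - t)) = Rintegral mu `[0, 1] f.
Proof.
move=> f0; rewrite /Rintegral; congr fine.
rewrite [LHS]integral_mkcond [RHS]integral_mkcond.
set F := (X in (integral mu setT X = _)%E).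
set G := (X in (_ = integral mu setT X)%E).
have GE x : G x = F (1 - x).
  rewrite /F /G /patch subKr; congr (if _ then _ else _).
  apply/idP/idP; rewrite !inE /= !in_itv /= => /andP[h1 h2]; apply/andP; split; lra.
have G0 x : (0 <= G x)%E.
  by rewrite /G /patch; case: ifP => //; rewrite inE /= in_itv /= lee_fin => /f0.
have F0 x : (0 <= F x)%E by rewrite -(subKr 1 x) -GE.
apply/eqP; rewrite eq_le (@ge0_integral_onem_le F G F0 GE) /=.
by apply: (@ge0_integral_onem_le G F G0) => x; rewrite GE subKr.
Qed.
End reflection.

(** * Reversal and concatenation of piecewise C^1 curves *)

Section distance.
Variables (R : realType) (n : nat) (M : riemannian_manifold R n).
Implicit Types (p q : M) (gamma : R -> M) (s : seq (R -> M)).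

Lemma Ck1_reverse gamma : Ck_curve 1 gamma -> Ck_curve 1 (fun t => gamma (1 - t)).
Proof.
case=> U [oU U01 cU dU].
have revE : (fun t : R => 1 - t) = (fun t : R => t *: (-1) + 1).
  by apply/funext => t; rewrite onem_affine.
have crev : continuous (fun t : R => 1 - t).
  by rewrite revE; exact: (@continuous_affine R R (-1) 1).
exists ((fun t : R => 1 - t) @^-1` U); split.
- by apply: open_comp => // t _; exact: crev.
- move=> t; rewrite /= in_itv /= => /andP[h1 h2]; apply: U01.
  by rewrite /= in_itv /=; apply/andP; split; lra.
- move=> t /= Ut; apply: (@continuous_comp _ _ _ (fun t : R => 1 - t) gamma).
    exact: crev.
  exact: cU.
- move=> i.
  have -> : chart i \o (fun t => gamma (1 - t)) =
            (fun t : R => (chart i \o gamma) (t *: (-1) + 1)).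
    by apply/funext => t /=; rewrite onem_affine.
  apply: (@Ck1_comp_affine R R _ _ _ _ (-1) 1); last exact: (dU i).
  by move=> t [] /=; rewrite onem_affine.
Qed.

Lemma tangent_normN p (v : tangent p) :
  tangent_norm (- (v : 'rV[R]_n) : tangent p) = tangent_norm v.
Proof. by rewrite /tangent_norm linearN /= mulmxN mulNmx mulNmx opprK. Qed.

Lemma tangent_norm_ge0 p (v : tangent p) : 0 <= tangent_norm v.
Proof. exact: sqrtr_ge0. Qed.

Lemma curve_length_ge0 gamma : 0 <= curve_length gamma.
Proof. by apply: Rintegral_ge0 => t _; exact: tangent_norm_ge0. Qed.

(** This is the chain rule: both velocities are read in the reference chart at [gamma (1 - t)], and
    the differential there is linear. *)
Lemma velocity_reverse gamma t : Ck_curve 1 gamma -> 0 <= t <= 1 ->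
  velocity (fun t => gamma (1 - t)) t = - (velocity gamma (1 - t) : 'rV[R]_n).
Proof.
case=> U [oU U01 cU dU] /andP[t0 t1]; rewrite /velocity.
set f := chart (chart_at (gamma (1 - t))) \o gamma.
have df : differentiable f (1 - t).
  apply: (dU _).1; split; last exact: chart_at_dom.
  by apply: U01; rewrite /= in_itv /=; apply/andP; split; lra.
have fE : chart (chart_at (gamma (1 - t))) \o (fun t => gamma (1 - t)) =
    (fun s : R => f (s *: (-1) + 1)).
  by apply/funext => s; rewrite /= onem_affine.
rewrite fE.
have := @derive_comp_affine R R _ f (-1) 1 t 1.
rewrite scale1r onem_affine => ->.
by rewrite !deriveE// linearN.
Qed.

Lemma curve_length_reverse gamma : Ck_curve 1 gamma ->
  curve_length (fun t => gamma (1 - t)) = curve_length gamma.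
Proof.
move=> gC; rewrite /curve_length.
transitivity (Rintegral (@lebesgue_measure R) `[0, 1]
    (fun t => tangent_norm (velocity gamma (1 - t)))).
  apply: eq_Rintegral => t; rewrite inE /= in_itv /= => t01.
  by rewrite velocity_reverse// tangent_normN.
apply: (Rintegral_onem (f := fun t => tangent_norm (velocity gamma t))) => t _.
exact: tangent_norm_ge0.
Qed.

Lemma piecewise_C1_cat p s q s' r :
  piecewise_C1 p s q -> piecewise_C1 q s' r -> piecewise_C1 p (s ++ s') r.
Proof.
elim: s p => [p /= ->//|g s IH p /= [gC gp sq] s'r].
by split => //; exact: IH sq s'r.
Qed.

Lemma piecewise_C1_reverse p s q : piecewise_C1 p s q ->
  exists2 s', piecewise_C1 q s' p &
    \sum_(g <- s') curve_length g = \sum_(g <- s) curve_length g.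
Proof.
elim: s p => [p /= ->|g s IH p /= [gC gp /IH[s' s'P s'E]]]; first by exists [::].
exists (s' ++ [:: fun t => g (1 - t)]).
  apply: piecewise_C1_cat s'P _; split; first exact: Ck1_reverse.
    by rewrite subr0.
  by rewrite /= subrr.
by rewrite big_cat big_seq1 big_cons s'E addrC curve_length_reverse.
Qed.

(** * Joining points by piecewise C^1 curves *)

(** A straight segment in chart coordinates is pulled back to the manifold. The open set [B]
    provides the neighbourhood of the unit interval that [Ck_curve] asks for. *)
Lemma chart_segment (i : chart_index M) p q (B : set 'rV[R]_n) :
  open B -> B `<=` chart i @` chart_dom i ->
  (forall t, 0 <= t <= 1 -> B (t *: (chart i q - chart i p) + chart i p)) ->
  chart_dom i p -> chart_dom i q ->
  piecewise_C1 p
    [:: fun t => chart_inv i (t *: (chart i q - chart i p) + chart i p)] q.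
Proof.
move=> oB BI Bseg ip iq.
pose w : 'rV[R]_n := chart i q - chart i p; pose x0 : 'rV[R]_n := chart i p.
rewrite -[chart i q - chart i p]/w -[chart i p]/x0.
split; last 2 first.
- by rewrite scale0r add0r chartK.
- by rewrite /= scale1r subrK chartK.
have ca := @continuous_affine R _ w x0.
exists ((fun t : R => t *: w + x0) @^-1` B); split.
- by apply: open_comp => // t _; exact: ca.
- by move=> t; rewrite /= in_itv /= => /Bseg.
- move=> t /= Bt; apply: (@continuous_comp _ _ _
      (fun t : R => t *: w + x0) (chart_inv i)); first exact: ca.
  by apply: chart_inv_continuous; exact: BI.
(* Read in a chart [j], the curve is the transition map from [i] to [j] along an affine segment. *)
- move=> j; have := transition_smooth i j 1 => tr.
  apply: (Ck1_comp_affine (U := chart i @` (chart_dom i `&` chart_dom j))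
    (f := chart j \o chart_inv i)); last exact: tr.
  move=> t [/= /BI[z zi zE]]; rewrite -/w -/x0 -zE chartK// => zj.
  by exists z.
Qed.

(** The image of a chart is open, so it contains a ball around [chart i p]; the preimage of this
    convex ball serves as [N]. *)
Lemma chart_ball_connected p : exists2 N : set M, nbhs p N &
  forall q r, N q -> N r -> exists s, piecewise_C1 q s r.
Proof.
set i := chart_at p; have ip : chart_dom i p by exact: chart_at_dom.
have : nbhs (chart i p) (chart i @` chart_dom i).
  by apply: open_nbhs_nbhs; split; [exact: chart_img_open|exists p].
rewrite -nbhs_ballE => -[e /= e0 Be].
exists (chart_dom i `&` chart i @^-1` (ball (chart i p) e)).
  apply: filterI.
    by apply: open_nbhs_nbhs; split => //; exact: chart_dom_open.
  by apply: (chart_continuous ip); exact: nbhsx_ballx.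
move=> q r [iq qB] [ir rB].
exists [:: fun t => chart_inv i (t *: (chart i r - chart i q) + chart i q)].
apply: (@chart_segment i q r (ball (chart i p) e)) => //.
  exact: ball_open.
by move=> t t01; exact: ball_segment.
Qed.

(* The set of points joined to p is open and closed. *)
Lemma piecewise_C1_connected p q : exists s, piecewise_C1 p s q.
Proof.
pose A := [set q | exists s, piecewise_C1 p s q].
suff : A = [set: M] by move/seteqP => [_ /(_ q I)].
apply: (carrier_connected (s := M)).
- by exists p, [::].
- exists A; last by rewrite setTI.
  rewrite openE => r [s sr].
  have [N Nr Nc] := chart_ball_connected r.
  apply: (filterS _ Nr) => z Nz.
  have [s' s'P] := Nc r z (nbhs_singleton Nr) Nz.
  by exists (s ++ s'); exact: piecewise_C1_cat sr s'P.
- exists A; last by rewrite setTI.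
  move=> r Ar.
  have [N Nr Nc] := chart_ball_connected r.
  have [z [[s sz] Nz]] := Ar _ Nr.
  have [s' s'P] := Nc z r Nz (nbhs_singleton Nr).
  by exists (s ++ s'); exact: piecewise_C1_cat sz s'P.
Qed.

(** * The geodesic distance is a pseudometric *)

Lemma sum_curve_length_ge0 s : 0 <= \sum_(g <- s) curve_length g.
Proof. by apply: sumr_ge0 => g _; exact: curve_length_ge0. Qed.

Lemma geodesic_dist_le p s q : piecewise_C1 p s q ->
  geodesic_dist p q <= \sum_(g <- s) curve_length g.
Proof.
move=> sP; apply: ge_inf; last by exists s.
by exists 0 => _ [s' _ <-]; exact: sum_curve_length_ge0.
Qed.

(** Connectedness enters here: the set of lengths is nonempty, so its infimum is not the default
    value 0. *)
Lemma le_geodesic_dist p q (x : R) :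
  (forall s, piecewise_C1 p s q -> x <= \sum_(g <- s) curve_length g) ->
  x <= geodesic_dist p q.
Proof.
move=> H; apply: lb_le_inf; last by move=> _ [s /= sP <-]; exact: H.
have [s sP] := piecewise_C1_connected p q.
by exists (\sum_(g <- s) curve_length g), s.
Qed.

Lemma geodesic_dist_ge0 p q : 0 <= geodesic_dist p q.
Proof. by apply: le_geodesic_dist => s _; exact: sum_curve_length_ge0. Qed.

Lemma geodesic_dist_refl p : geodesic_dist p p = 0.
Proof.
apply/eqP; rewrite eq_le geodesic_dist_ge0 andbT.
by rewrite (le_trans (@geodesic_dist_le p [::] p erefl))// big_nil.
Qed.

Lemma geodesic_dist_sym p q : geodesic_dist p q = geodesic_dist q p.
Proof.
suff H p' q' : geodesic_dist p' q' <= geodesic_dist q' p'.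
  by apply/eqP; rewrite eq_le !H.
apply: le_geodesic_dist => s /piecewise_C1_reverse[s' s'P <-].
exact: geodesic_dist_le.
Qed.

(** The infimum is taken over the two families of curves in turn, and concatenated curves are
    competitors for the left-hand side. *)
Lemma geodesic_dist_triangle p q r :
  geodesic_dist p r <= geodesic_dist p q + geodesic_dist q r.
Proof.
rewrite -lerBlDr; apply: le_geodesic_dist => s sP.
rewrite lerBlDr -lerBlDl; apply: le_geodesic_dist => s' s'P.
rewrite lerBlDl -big_cat; apply: geodesic_dist_le.
exact: piecewise_C1_cat sP s'P.
Qed.

End distance.

(** * Minimizers of weighted sums of squared distances *)

Section weighted_sum.
Variables (R : realType) (T : Type) (rho : T -> T -> R).
Hypothesis rho_ge0 : forall p q, 0 <= rho p q.
Hypothesis rho_sym : forall p q, rho p q = rho q p.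
Hypothesis rho_triangle : forall p q r, rho p r <= rho p q + rho q r.

Lemma argmin_dist_le (I : choiceType) (w : I -> R) (y : I -> T) (A r : R)
    (x p : T) :
  finite_set [set i | w i != 0] ->
  \sum_(i \in [set: I]) w i = 1 ->
  \sum_(i \in [set: I]) `|w i| <= A ->
  0 <= r ->
  (forall i, w i != 0 -> rho p (y i) <= r) ->
  (forall z, \sum_(i \in [set: I]) w i * rho x (y i) ^+ 2 <=
             \sum_(i \in [set: I]) w i * rho z (y i) ^+ 2) ->
  rho x p <= (2 * A + 1) * r.
Proof.
move=> wfin w1 wA r0 pr /(_ p).
(* All the sums are reduced to one list enumerating the support of [w]. *)
pose X : seq I := finmap.enum_fset (fset_set [set i | w i != 0]).
have sumE (F : I -> R) : (forall i, w i = 0 -> F i = 0) ->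
    \sum_(i \in [set: I]) F i = \sum_(i <- X) F i.
  move=> F0; apply: fsbigTE => i; rewrite in_fset_set// => /negP iX; apply: F0.
  by apply/eqP/negPn/negP => wi; apply: iX; rewrite inE.
rewrite !sumE; [|by move=> i ->; rewrite mul0r..].
rewrite sumE// in w1; rewrite sumE in wA; last by move=> i ->; rewrite normr0.
set D := rho x p => Emin.
have D0 : 0 <= D by exact: rho_ge0.
have A0 : 0 <= A by apply: le_trans wA; exact: sumr_ge0.
have le1 : \sum_(i <- X) w i * rho p (y i) ^+ 2 <= A * r ^+ 2.
  apply: (@le_trans _ _ (\sum_(i <- X) `|w i| * r ^+ 2)); last first.
    by rewrite -mulr_suml ler_wpM2r// sqr_ge0.
  apply: ler_sum => i _; have [->|wi] := eqVneq (w i) 0.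
    by rewrite mul0r normr0 mul0r.
  apply: (le_trans (ler_norm _)); rewrite normrM ler_wpM2l// ger0_norm ?sqr_ge0//.
  by rewrite ler_sqr ?nnegrE// pr.
have le2 : D ^+ 2 - A * (2 * D * r + r ^+ 2) <=
    \sum_(i <- X) w i * rho x (y i) ^+ 2.
  apply: (@le_trans _ _ (\sum_(i <- X)
      (w i * D ^+ 2 - `|w i| * (2 * D * r + r ^+ 2)))).
    rewrite sumrB -!mulr_suml w1 mul1r lerD2l lerN2 ler_wpM2r//.
    by rewrite addr_ge0 ?sqr_ge0// !mulr_ge0.
  apply: ler_sum => i _; have [->|wi] := eqVneq (w i) 0.
    by rewrite normr0 !mul0r subr0.
  have h1 := rho_triangle x p (y i); have h2 := rho_triangle x (y i) p.
  rewrite (rho_sym (y i) p) in h2; have h3 := pr i wi.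
  have h4 := rho_ge0 x (y i); rewrite -/D in h1 h2.
  move: h1 h2 h3 h4; set e := rho x (y i); set f := rho p (y i) => h1 h2 h3 h4.
  (* Weights may be negative, so the difference of the squares of [D] and [e] is bounded in absolute
     value. Both signs follow from the distance between [D] and [e] being at most [r]. *)
  rewrite lerBlDr -lerBlDl -mulrBr; apply: (le_trans (ler_norm _)).
  rewrite normrM ler_wpM2l// ler_norml; apply/andP; split; last nra.
  by nra.
have main : D ^+ 2 <= 2 * A * r * D + 2 * A * r ^+ 2 by lra.
(* If [D] exceeded (2 A + 1) r, then D^2 > 2 A r D + r D and r D >= 2 A r^2 + r^2, against
   [main]. *)
rewrite leNgt; apply/negP => ltD.
have Ar0 : 0 <= A * r by rewrite mulr_ge0.
have D_gt0 : 0 < D.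
  by apply: le_lt_trans ltD; rewrite mulr_ge0// addr_ge0// mulr_ge0.
have h1 : 0 < D * (D - (2 * A + 1) * r) by rewrite mulr_gt0// subr_gt0.
have h2 : 0 <= r * (D - (2 * A + 1) * r) by rewrite mulr_ge0// subr_ge0 ltW.
have h3 : 0 <= r ^+ 2 by rewrite sqr_ge0.
lra.
Qed.

(** The triangle inequality is iterated along consecutive indices; symmetry reduces to [k <= j]. *)
Lemma int_chain_le (c : int -> T) (d : R) : 0 <= d -> (forall p, rho p p = 0) ->
  (forall k, rho (c (k + 1)) (c k) <= d) ->
  forall j k, rho (c j) (c k) <= `|j - k|%:~R * d.
Proof.
move=> d0 rho0 cd.
have step (m : nat) k : rho (c (k + m%:Z)) (c k) <= m%:R * d.
  elim: m => [|m IH]; first by rewrite addr0 rho0 mul0r.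
  apply: (le_trans (rho_triangle _ (c (k + m%:Z)) _)).
  have -> : k + m.+1%:Z = k + m%:Z + 1 by rewrite intS; ring.
  by rewrite -natr1 mulrDl mul1r [leRHS]addrC lerD.
move=> j k; wlog kj : j k / k <= j.
  move=> H; case: (leP k j) => [/H//|/ltW /H].
  by rewrite rho_sym distrC.
have /ger0_norm e : 0 <= j - k by rewrite subr_ge0.
rewrite e; have := step `|j - k|%N k.
by rewrite gez0_abs ?subr_ge0// subrKC natr_absz e.
Qed.
End weighted_sum.

(** * Supports and sums of the masks *)

Section masks.
Variable R : realType.
Implicit Types alpha gamma : int -> R.

Lemma finitely_supported_bound alpha : finitely_supported alpha ->
  exists N : nat, forall i, alpha i != 0 -> `|i| <= N%:Z.
Proof.
move=> afin.
pose s : seq int := finmap.enum_fset (fset_set [set i | alpha i != 0]).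
exists (\max_(i <- s) `|i|%N) => i ai.
rewrite -abszE lez_nat.
apply: (@leq_bigmax_seq _ s xpredT (fun i : int => `|i|%N)) => //.
by rewrite in_fset_set// inE.
Qed.

(** Writing k = 2 m + b and substituting m - i for i shows that the refinement rule at [k] sees only
    the even or only the odd part of the mask. This matches the two halves of [shift_invariant]. *)
Lemma refine_mask_sum (F : int -> R) (k : int) : exists b : bool,
  \sum_(i \in [set: int]) F (k - 2 * i) =
  \sum_(i \in [set: int]) F (2 * i + b%:Z).
Proof.
have [m [b ->]] : exists m : int, exists b : bool, k = 2 * m + b%:Z.
  exists (k %/ 2)%Z.
  have h1 := divz_eq k 2.
  have h2 : (0 <= (k %% 2)%Z < 2) by rewrite modz_ge0// ltz_pmod.
  have [h|h] : (k %% 2)%Z = 0 \/ (k %% 2)%Z = 1 by lia.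
    by exists false; lia.
  by exists true; lia.
exists b; rewrite (@reindex_fsbigT _ _ _ _ _ (fun i : int => m - i)); last first.
  by exists (fun i => m - i) => i; rewrite subKr.
by apply: eq_fsbigr => i _; congr F; ring.
Qed.

Lemma finite_support_comp (h : int -> int) alpha :
  injective h -> finitely_supported alpha ->
  finite_set [set i | alpha (h i) != 0].
Proof.
move=> hI afin; apply: (@finite_preimage _ _ [set i | alpha i != 0] h) => //.
by move=> x y _ _; exact: hI.
Qed.

Lemma decimation_mask_fin gamma eps : truncated_sum gamma eps != 0 ->
  finitely_supported (decimation_mask gamma eps).
Proof.
move=> s0; rewrite /finitely_supported.
apply: (@sub_finite_set _ _ ([set i | eps < `|gamma i|] `&`
    truncated gamma eps @^-1` [set~ 0])).
  move=> i /=; rewrite /decimation_mask /truncated.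
  case: ifP => [e h|]; last by rewrite mul0r eqxx.
  by split => // g0; rewrite g0 mul0r eqxx in h.
(* A sum over an infinite support has the default value 0, so a nonzero [truncated_sum] forces
   finiteness. *)
by apply: contrapT => sinf; move/eqP: s0; apply; exact: fsbig_dflt sinf.
Qed.

Lemma decimation_mask_sum gamma eps : truncated_sum gamma eps != 0 ->
  \sum_(i \in [set: int]) decimation_mask gamma eps i = 1.
Proof.
move=> s0; rewrite /decimation_mask -mulr_fsuml.
rewrite -(fsbig_widen [set i | eps < `|gamma i|])//; first exact: divff.
by move=> i [_ /=]; rewrite /truncated => /negP/negbTE ->.
Qed.

End masks.

(** * Displacement under one decimation and one refinement *)

Section one_level.
Variables (R : realType) (n : nat) (M : riemannian_manifold R n).
Variables alpha zeta : int -> R.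

Lemma decimate_dist_le : finitely_supported zeta ->
  \sum_(i \in [set: int]) zeta i = 1 ->
  exists2 B : R, 0 <= B & forall (c : int -> M) (d : R), 0 <= d ->
    admissible alpha zeta c ->
    (forall k, geodesic_dist (c (k + 1)) (c k) <= d) ->
    forall k, geodesic_dist (decimate zeta c k) (c (2 * k)) <= B * d.
Proof.
move=> zfin z1; have [N zN] := finitely_supported_bound zfin.
pose A := \sum_(i \in [set: int]) `|zeta i|.
have A0 : 0 <= A by exact: fsumr_ge0.
(* If i contributes, then |k - i| <= N, so c_(2i) is at most 2 N steps from c_(2k); the radius is 2
   N d. *)
exists ((2 * A + 1) * (2 * N%:R)).
  by rewrite mulr_ge0 ?mulr_ge0// addr_ge0// mulr_ge0.
move=> c d d0 cadm cd k; rewrite -mulrA.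
have kb : bijective (fun i : int => k - i).
  by exists (fun i => k - i) => i; rewrite subKr.
apply: (argmin_dist_le (@geodesic_dist_ge0 _ _ M) (@geodesic_dist_sym _ _ M)
  (@geodesic_dist_triangle _ _ M) (w := fun i => zeta (k - i))
  (y := fun i => c (2 * i))).
- exact: finite_support_comp (bij_inj kb) zfin.
- by rewrite -z1 [RHS](@reindex_fsbigT _ _ _ _ _ _ _ kb).
- by rewrite /A [leRHS](@reindex_fsbigT _ _ _ _ _ _ _ kb).
- by rewrite mulr_ge0// mulr_ge0.
- move=> i /zN iN.
  apply: le_trans (int_chain_le (@geodesic_dist_sym _ _ M)
    (@geodesic_dist_triangle _ _ M) d0 (@geodesic_dist_refl _ _ M) cd _ _) _.
  rewrite ler_wpM2r// -mulrBr normrM intrM ler_wpM2l//.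
  by rewrite -(ler_int R) in iN.
(* Admissibility provides a minimizer, so [decimate] does not return its default value. *)
- have [_ [x [xP _]]] := cadm k.
  exact: (xgetPex (c k) (ex_intro _ x xP)).
Qed.

(** Here [b] stands for the coarse sequence, each [b i] being near [c (2 * i)]. A contributing index
    has |k - 2 i| <= N, so [b i] lies within N d + e of [c k], hence within (N + 1)(d + e). *)
Lemma refine_dist_le : finitely_supported alpha -> shift_invariant alpha ->
  exists2 B : R, 0 <= B & forall (b c : int -> M) (d e : R), 0 <= d -> 0 <= e ->
    admissible alpha zeta b ->
    (forall k, geodesic_dist (c (k + 1)) (c k) <= d) ->
    (forall k, geodesic_dist (b k) (c (2 * k)) <= e) ->
    forall k, geodesic_dist (refine alpha b k) (c k) <= B * (d + e).
Proof.
move=> afin [a0 a1]; have [N aN] := finitely_supported_bound afin.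
pose P (b : bool) := \sum_(i \in [set: int]) `|alpha (2 * i + b%:Z)|.
have P0 b : 0 <= P b by exact: fsumr_ge0.
(* Adding both parities gives a bound on the absolute weights that is uniform in [k]. *)
pose A := P false + P true.
have A0 : 0 <= A by rewrite addr_ge0.
exists ((2 * A + 1) * (N%:R + 1)).
  by rewrite mulr_ge0// addr_ge0// mulr_ge0.
move=> b c d e d0 e0 badm cd bc k.
have de0 : 0 <= d + e by rewrite addr_ge0.
rewrite -mulrA.
apply: (argmin_dist_le (@geodesic_dist_ge0 _ _ M) (@geodesic_dist_sym _ _ M)
  (@geodesic_dist_triangle _ _ M) (w := fun i => alpha (k - 2 * i)) (y := b)).
- apply: finite_support_comp afin => i j; lia.
- have [[] ->] := refine_mask_sum alpha k; first exact: a1.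
  by rewrite -a0; apply: eq_fsbigr => i _; rewrite addr0.
- have [[] ->] := refine_mask_sum (fun i => `|alpha i|) k.
    by rewrite -/(P true) lerDr.
  by rewrite -/(P false) lerDl.
- by rewrite mulr_ge0// addr_ge0.
- move=> i /aN iN.
  apply: (le_trans (geodesic_dist_triangle _ (c (2 * i)) _)).
  rewrite [geodesic_dist (c (2 * i)) _]geodesic_dist_sym.
  rewrite [(N%:R + 1) * _]mulrDl mul1r.
  apply: lerD; last by rewrite (le_trans (bc i))// lerDr.
  apply: le_trans (int_chain_le (@geodesic_dist_sym _ _ M)
    (@geodesic_dist_triangle _ _ M) d0 (@geodesic_dist_refl _ _ M) cd _ _) _.
  by apply: ler_pM => //; [rewrite -(ler_int R) in iN|rewrite lerDl].
- have [[x [xP _]] _] := badm k.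
  exact: (xgetPex (b k) (ex_intro _ x xP)).
Qed.

End one_level.

(** * The bound on the detail coefficients *)

Theorem theorem5p4 (R : realType) (n : nat) (M : riemannian_manifold R n)
    (alpha gamma zeta : int -> R) (eps : R)
    (alpha_fin : finitely_supported alpha)
    (alpha_shift : shift_invariant alpha)
    (alpha_conv : convergent_subdivision alpha)
    (gamma_inv : forall k, convolution gamma (downsample alpha) k = kronecker R k)
    (gamma_sum : sums_to gamma 1)
    (gamma_decay : exponential_decay gamma)
    (eps_gt0 : 0 < eps)
    (trunc_neq0 : truncated_sum gamma eps != 0)
    (zeta_def : zeta = decimation_mask gamma eps)
    (T_stable : stable M alpha zeta) :
  exists2 K : R, 0 <= K &
    forall (J : nat) (c : nat -> int -> M),
      (forall l : nat, (1 <= l <= J)%N -> c l.-1 = decimate zeta (c l)) ->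
      (forall l : nat, (l <= J)%N -> admissible alpha zeta (c l)) ->
      (forall l : nat, (1 <= l <= J)%N -> forall k : int,
        log_defined (refine alpha (c l.-1) k) (c l k)) ->
      forall l : nat, (1 <= l <= J)%N ->
        (detail_norm alpha c l <= K%:E * Delta (c l))%E.
Proof.
have zfin : finitely_supported zeta.
  by rewrite zeta_def; exact: decimation_mask_fin.
have zsum : \sum_(i \in [set: int]) zeta i = 1.
  by rewrite zeta_def; exact: decimation_mask_sum.
have [B B0 decB] := decimate_dist_le M alpha zfin zsum.
have [C C0 refC] := refine_dist_le M zeta alpha_fin alpha_shift.
have K1 : 0 < C * (1 + B) + 1 by rewrite ltr_wpDl// mulr_ge0// addr_ge0.
(* The summand 1 makes the constant positive, so that its product with an infinite [Delta (c l)] is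
   infinite rather than 0. *)
exists (C * (1 + B) + 1); first exact: ltW.
move=> J c cdec cadm clog l /[dup] l1J /andP[l1 lJ].
have Dge k : ((geodesic_dist (c l (k + 1)) (c l k))%:E <= Delta (c l))%E.
  by apply: ereal_sup_ubound; exists k.
have D0 : (0 <= Delta (c l))%E.
  by apply: le_trans (Dge 0); rewrite lee_fin geodesic_dist_ge0.
case: (Delta (c l)) Dge D0 => [d| |//] Dge D0; last first.
  by rewrite mulry gtr0_sg// mul1e leey.
rewrite lee_fin in D0.
have cd k : geodesic_dist (c l (k + 1)) (c l k) <= d by rewrite -lee_fin.
apply: ge_ereal_sup => _ [k _ <-]; rewrite -EFinM lee_fin.
(* Since the logarithm exists, [ominus] selects a genuine one, whose norm is the geodesic distance
   from the refined point to [c l k]. *)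
have [v [vlog _]] := clog l l1J k.
have [_ ->] : is_log (c l k) (detail alpha c l k)
  by exact: (xgetPex _ (ex_intro _ v vlog)).
have BdB : 0 <= B * d by rewrite mulr_ge0.
(* The refinement bound is applied to the decimated sequence, with the decimation error [B * d] as
   e. *)
apply: (@le_trans _ _ (C * (d + B * d))).
  apply: refC => //; first by apply: cadm; rewrite (leq_trans (leq_pred l)).
  by move=> j; rewrite cdec//; apply: decB => //; exact: cadm.
by rewrite mulrDl mul1r -[X in X + B * d]mul1r -mulrDl mulrA lerDl.
Qed.
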